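(* Let $\mathbf{F}$ be a field of characteristic different from $2$, let $\mathcal{A}$ be the commutative and associative $\mathbf{F}$-algebra with basis $\{b_0, a_1, b_1, a_2, b_2, \dots\}$ described in the context, let $D_0$ be the linear transformation of $\mathcal{A}$ with $D_0(a_n)=n b_n$ for $n\ge 1$ and $D_0(b_n)=n a_n$ for $n\ge 0$, and let $a$ be an element of $\mathcal{A}$. Let $aD_0$ denote the linear map $c\mapsto a\,D_0(c)$, and define a bilinear operation $\circ$ on $\mathcal{A}$ by $$b\circ c = b\,a\,D_0(c)\qquad \text{for all } b,c\in\mathcal{A}.$$ Then: 1) $(\mathcal{A}, aD_0, \circ)$, that is, $\mathcal{A}$ with the product $\circ$, is a Novikov algebra over $\mathbf{F}$. 2) The adjoining Lie algebra $(\mathcal{A}, aD_0, [\,,])$ of $(\mathcal{A}, aD_0, \circ)$ is a Lie algebra whose bracket is given by $$[b,c]=a\bigl(b D_0(c)-c D_0(b)\bigr)\qquad\text{for all } b,c\in\mathcal{A}.$$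
   Context: The algebra $\mathcal{A}$: a vector space over $\mathbf{F}$ with basis $\{b_0,a_1,b_1,a_2,b_2,\dots,a_n,b_n,\dots\}$ and the bilinear product determined on basis elements by $$a_m a_n=\tfrac12(b_{m+n}-b_{m-n}),\qquad b_m b_n=\tfrac12(b_{m+n}+b_{m-n}),\qquad a_m b_n=b_n a_m=\tfrac12(a_{m+n}+a_{m-n}),$$ with the conventions $b_{-m}=b_m$ and $a_{-m}=-a_m$ (so $a_0=0$). This product is commutative and associative. A Novikov algebra over $\mathbf{F}$ is an $\mathbf{F}$-vector space with a bilinear product $\circ$ such that for all $x,y,z$: $x\circ(y\circ z)-(x\circ y)\circ z=y\circ(x\circ z)-(y\circ x)\circ z$ and $(x\circ y)\circ z=(x\circ z)\circ y$. The adjoining Lie algebra of a Novikov algebra (more generally, of a left symmetric algebra, i.e. one satisfying the first of these identities) with product $\circ$ is the same vector space with bracket $[x,y]=x\circ y-y\circ x$. *)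

(* Defs.v *)
From HB Require Import structures.
From mathcomp Require Import all_boot all_order all_algebra.
From mathcomp.multinomials Require Import freeg.

Set Implicit Arguments.
Unset Strict Implicit.
Unset Printing Implicit Defensive.

Import GRing.Theory.
Local Open Scope ring_scope.

Section NonAssociative.
Variables (F : fieldType) (V : lmodType F).
Implicit Type op : V -> V -> V.

Record is_left_symmetric op : Prop := IsLeftSymmetric {
  left_symmetric_bilinear : bilinear_for *:%R *:%R op;
  left_symmetricE : forall x y z,
    op x (op y z) - op (op x y) z = op y (op x z) - op (op y x) z
}.

Record is_novikov op : Prop := IsNovikov {
  novikov_left_symmetric : is_left_symmetric op;
  novikov_right_commutative : forall x y z, op (op x y) z = op (op x z) y
}.

Record is_lie_bracket op : Prop := IsLieBracket {
  lie_bilinear : bilinear_for *:%R *:%R op;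
  lie_alternating : forall x, op x x = 0;
  lie_jacobi : forall x y z,
    op x (op y z) + op y (op z x) + op z (op x y) = 0
}.

Definition adjoining_bracket op (x y : V) : V := op x y - op y x.

End NonAssociative.

(* The underlying vector space of A is free on the labels [inl n], standing for
   b_n, and [inr n], standing for a_(n+1), since a_0 = 0 is not a basis vector. *)
Notation label := (nat + nat)%type.
Notation algA F := {freeg label / F}.

Section AlgebraA.
Variable F : fieldType.

(* a_m and b_m for every integer m, with a_(-m) = - a_m and b_(-m) = b_m. *)
Definition vec_a (m : int) : algA F :=
  match m with
  | Posz 0 => 0
  | Posz n.+1 => << inr n : label >>
  | Negz n => - << inr n : label >>
  end.

Definition vec_b (m : int) : algA F := << inl `|m|%N : label >>.

Definition mul_basis (i j : label) : algA F :=
  match i, j with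
  | inl m, inl n => 2^-1 *: (vec_b (m%:Z + n%:Z) + vec_b (m%:Z - n%:Z))
  | inr m, inr n =>
      2^-1 *: (vec_b (m.+1%:Z + n.+1%:Z) - vec_b (m.+1%:Z - n.+1%:Z))
  | inr m, inl n | inl n, inr m =>
      2^-1 *: (vec_a (m.+1%:Z + n%:Z) + vec_a (m.+1%:Z - n%:Z))
  end.

(* [fglift f] is the linear map that takes the values [f] on the basis. *)
Definition algA_mul (u v : algA F) : algA F :=
  fglift (fun i => fglift (mul_basis i) v) u.

Definition D0_basis (i : label) : algA F :=
  match i with
  | inl n => n%:R *: vec_a n%:Z
  | inr n => n.+1%:R *: vec_b n.+1%:Z
  end.

Definition D0 (u : algA F) : algA F := fglift D0_basis u.

(* The map written a D_0: the multiple of D_0 by the element a. *)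
Definition scaled_D0 (a c : algA F) : algA F := algA_mul a (D0 c).

Definition circ (a b c : algA F) : algA F := algA_mul b (scaled_D0 a c).

End AlgebraA.

(* Main.v *)
(** For every integer [m] put [e_m = b_m + a_m]. These vectors span the algebra
    because [2] is invertible, and the defining relations say that
    [e_m e_n = e_(m+n)] and [D_0 e_m = m e_m]: the algebra is the ring of Laurent
    polynomials in [t = e_1], and [D_0] is the derivation [t d/dt]. Hence [a D_0] is
    a derivation of a commutative associative algebra, and [b (a D_0)(c)] is a
    Novikov product by Gelfand's construction. *)

Require Import Defs.
From HB Require Import structures.
From mathcomp Require Import all_boot all_order all_algebra.
From mathcomp.multinomials Require Import freeg.

Set Implicit Arguments.
Unset Strict Implicit.
Unset Printing Implicit Defensive.

Import GRing.Theory.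
Local Open Scope ring_scope.

(** * Left symmetric and Novikov algebras *)

Section LeftSymmetric.
Variables (F : fieldType) (V : lmodType F).
Implicit Types (op : V -> V -> V) (d : V -> V).

(** The twelve terms of the Jacobi sum regroup into left symmetry at [(x, y, z)] and its two cyclic
    shifts. *)
Lemma left_symmetric_lie op :
  is_left_symmetric op -> is_lie_bracket (adjoining_bracket op).
Proof.
move=> [[linl linr] lsym].
have linL k x y z : op (k *: x + y) z = k *: op x z + op y z := linl z k x y.
have linR k x y z : op z (k *: x + y) = k *: op z x + op z y := linr z k x y.
have opBl z : {morph op^~ z : x y / x - y} by exact: GRing.zmod_morphism_linear (linl z).
have opBr z : {morph op z : x y / x - y} by exact: GRing.zmod_morphism_linear (linr z).
split=> [||x y z]; rewrite /adjoining_bracket.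
- by split=> [z k x y|x k y z] /=; rewrite linL linR scalerBr opprD addrACA.
- by move=> x; rewrite subrr.
rewrite !opBl !opBr.
(* [p], [q], [r] stand for the products with [x], [y], [z] outermost on the left, and [s], [t], [u]
   for those with [z], [x], [y] outermost on the right. *)
have cancel3 p1 p2 q1 q2 r1 r2 s1 s2 t1 t2 u1 u2 :
  p1 - s1 = q2 - s2 -> q1 - t1 = r2 - t2 -> r1 - u1 = p2 - u2 ->
  (p1 - p2 - (t1 - t2)) + (q1 - q2 - (u1 - u2)) + (r1 - r2 - (s1 - s2)) = 0 :> V.
  move=> /eqP; rewrite -subr_eq0 => /eqP E1.
  move=> /eqP; rewrite -subr_eq0 => /eqP E2.
  move=> /eqP; rewrite -subr_eq0 => /eqP E3.
  transitivity ((p1 - s1 - (q2 - s2)) + (q1 - t1 - (r2 - t2)) + (r1 - u1 - (p2 - u2))).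
    by rewrite !opprB !addrA [LHS](ACl (1*12*11*6*5*4*3*10*9*8*7*2)).
  by rewrite E1 E2 E3 !addr0.
exact: cancel3.
Qed.

(* Gelfand's construction: the associator [x (y z) - (x y) z] of the new product
   is [x y d(d z)], which is symmetric in [x] and [y]. *)
Lemma gelfand_novikov op d :
    bilinear_for *:%R *:%R op -> associative op -> commutative op -> linear d ->
    (forall x y, d (op x y) = op (d x) y + op x (d y)) ->
  is_novikov (fun x y => op x (d y)).
Proof.
move=> [linl linr] opA opC lind leib.
have linL k x y z : op (k *: x + y) z = k *: op x z + op y z := linl z k x y.
have linR k x y z : op z (k *: x + y) = k *: op z x + op z y := linr z k x y.
have opDr z : {morph op z : x y / x + y}.
  by move=> x y; rewrite -{1}[x]scale1r linR scale1r.
split=> [|x y z]; last by rewrite -!opA [op (d y) _]opC.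
split=> [|x y z]; first by split=> [z k x y|x k y z] /=; rewrite ?lind (linL, linR).
by rewrite !leib !opDr !opA !(addrAC _ _ (- _)) !subrr !add0r [op x y]opC.
Qed.

End LeftSymmetric.

(** * Linear extension from a basis *)

Section FreeLift.
Variables (F : fieldType) (K : choiceType).
Implicit Types (u v : {freeg K / F}).

Lemma freeg_linear_ind (P : {freeg K / F} -> Prop) :
    P 0 -> (forall k u v, P u -> P v -> P (k *: u + v)) ->
    (forall x, P << x >>) ->
  forall u, P u.
Proof.
move=> P0 PD PU; elim/freeg_ind_dom0 => // k x u _ _ Pu.
have -> : << k *g x >> = k *: << x >> :> {freeg K / F}.
  by apply/eqP/freeg_eqP => y; rewrite coeffZ !coeffU mul1r.
exact: PD.
Qed.

Lemma fglift_linear (M : lmodType F) (f : K -> M) : linear (fglift f).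
Proof.
have liftB := lift_is_additive f.
have lift0 : fglift f 0 = 0 by rewrite -(subrr 0) liftB subrr.
have liftD : {morph fglift f : u v / u + v}.
  (* Compatibility with differences is what is known so far, so [u + v] is read as [u - (0 - v)]. *)
  by move=> u v; rewrite -[v in LHS]opprK -[- v]sub0r !liftB lift0 sub0r opprK.
move=> k u v; rewrite liftD; congr (_ + _).
elim/freeg_ind_dom0: u => [|c x u _ _ IH]; first by rewrite scaler0 lift0 scaler0.
have scaleU : k *: << c *g x >> = << k * c *g x >> :> {freeg K / F}.
  by apply/eqP/freeg_eqP => y; rewrite coeffZ !coeffU mulrA.
by rewrite scalerDr !liftD IH scalerDr scaleU !liftU scalerA.
Qed.

HB.instance Definition _ (M : lmodType F) (f : K -> M) :=
  GRing.isLinear.Build F {freeg K / F} M *:%R (fglift f) (fglift_linear f).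

Lemma fgliftU1 (M : lmodType F) (f : K -> M) x : fglift f << x >> = f x.
Proof. by rewrite liftU scale1r. Qed.

End FreeLift.

(** * The algebra and its derivation *)

Section AlgebraA.
Variables (F : fieldType).
Implicit Types (u v w : algA F) (m n : int).

Lemma algA_mul_linearl v : linear (@algA_mul F ^~ v).
Proof. exact: fglift_linear. Qed.

(** The product is a lift in its left argument; once that argument is a basis vector, it is a lift
    in the right one too. *)
Lemma algA_mul_linearr u : linear (algA_mul u).
Proof.
move=> k v w; elim/freeg_linear_ind: u => [|c u u' IH IH'|i].
- by rewrite /algA_mul !(linear0 (fglift _)) scaler0 addr0.
- rewrite !(algA_mul_linearl _ c) IH IH' !scalerDr !scalerA [k * c]mulrC.
  by rewrite addrACA.
- by rewrite /algA_mul !fgliftU1 fglift_linear.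
Qed.

HB.instance Definition _ :=
  bilinear_isBilinear.Build F (algA F) (algA F) (algA F) *:%R *:%R (@algA_mul F)
    (algA_mul_linearl, algA_mul_linearr).

HB.instance Definition _ :=
  GRing.isLinear.Build F (algA F) (algA F) *:%R (@D0 F) (fglift_linear _).

Lemma vec_aN m : vec_a F (- m) = - vec_a F m.
Proof. by case: m => [[|n]|n] /=; rewrite ?oppr0 ?opprK. Qed.

Lemma vec_bN m : vec_b F (- m) = vec_b F m.
Proof. by rewrite /vec_b abszN. Qed.

(** Labels give the relations at natural indices only; the parity of [vec_a] and [vec_b] carries
    them to all integers. *)
Lemma intN_ind (P : int -> Prop) :
  (forall n : nat, P n) -> (forall m, P m -> P (- m)) -> forall m, P m.
Proof. by move=> Pn PN [n|n] //; rewrite NegzE; apply: PN. Qed.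

Lemma mul_vec_bb m n :
  algA_mul (vec_b F m) (vec_b F n) = 2^-1 *: (vec_b F (m + n) + vec_b F (m - n)).
Proof.
elim/intN_ind: n => [n|n IH]; last by rewrite vec_bN IH opprK addrC.
elim/intN_ind: m => [m|m IH].
  by rewrite /algA_mul !fgliftU1.
by rewrite vec_bN IH [- m + _]addrC -(opprB m) -opprD !vec_bN addrC.
Qed.

Lemma mul_vec_ab m n :
  algA_mul (vec_a F m) (vec_b F n) = 2^-1 *: (vec_a F (m + n) + vec_a F (m - n)).
Proof.
elim/intN_ind: n => [n|n IH]; last by rewrite vec_bN IH opprK addrC.
elim/intN_ind: m => [[|m]|m IH].
(* Index 0 is apart because $a_0 = 0$ is not a basis vector; here $a_n + a_{-n} = 0$. *)
- by rewrite linear0l add0r sub0r vec_aN subrr scaler0.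
- by rewrite /algA_mul !fgliftU1.
- by rewrite vec_aN linearNl /= IH [- m + _]addrC -(opprB m) -opprD !vec_aN -scalerN opprD addrC.
Qed.

(** Commutativity comes later and rests on this formula. The index of $a$ stays first, as $a_{n-m} =
    -a_{m-n}$. *)
Lemma mul_vec_ba m n :
  algA_mul (vec_b F m) (vec_a F n) = 2^-1 *: (vec_a F (n + m) + vec_a F (n - m)).
Proof.
elim/intN_ind: m => [m|m IH]; last by rewrite vec_bN IH opprK addrC.
elim/intN_ind: n => [[|n]|n IH].
- by rewrite linear0r add0r sub0r vec_aN subrr scaler0.
- by rewrite /algA_mul !fgliftU1.
- by rewrite vec_aN linearNr /= IH [- n + _]addrC -(opprB n) -opprD !vec_aN -scalerN opprD addrC.
Qed.

Lemma mul_vec_aa m n :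
  algA_mul (vec_a F m) (vec_a F n) = 2^-1 *: (vec_b F (m + n) - vec_b F (m - n)).
Proof.
elim/intN_ind: n => [n|n IH]; last first.
  by rewrite vec_aN linearNr /= IH opprK -scalerN opprB.
elim/intN_ind: m => [m|m IH]; last first.
  by rewrite vec_aN linearNl /= IH [- m + _]addrC -(opprB m) -opprD !vec_bN -scalerN opprB.
case: m n => [|m] [|n].
- by rewrite linear0l subrr scaler0.
- by rewrite linear0l add0r sub0r vec_bN subrr scaler0.
- by rewrite linear0r addr0 subrr scaler0.
- by rewrite /algA_mul !fgliftU1.
Qed.

Lemma D0_vec_a m : D0 (vec_a F m) = m%:~R *: vec_b F m.
Proof.
elim/intN_ind: m => [[|m]|m IH]; first by rewrite linear0 scale0r.
  by rewrite /D0 fgliftU1.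
by rewrite vec_aN vec_bN linearN /= IH mulrNz scaleNr.
Qed.

Lemma D0_vec_b m : D0 (vec_b F m) = m%:~R *: vec_a F m.
Proof.
elim/intN_ind: m => [m|m IH]; first by rewrite /D0 fgliftU1.
by rewrite vec_aN vec_bN IH mulrNz scaleNr scalerN opprK.
Qed.

(** $b_m$ and $a_m$ multiply like $\cosh mx$ and $\sinh mx$, so their sum plays the role of
    $e^{mx}$. *)
Definition vec_exp m : algA F := vec_b F m + vec_a F m.

Lemma D0_exp m : D0 (vec_exp m) = m%:~R *: vec_exp m.
Proof. by rewrite linearD /= D0_vec_a D0_vec_b -scalerDr addrC. Qed.

(** * Reduction to exponentials, where 2 is invertible *)

Hypothesis charF : 2%N \notin [pchar F].

Lemma two_neq0 : 2 != 0 :> F.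
Proof. by move: charF; rewrite inE. Qed.

Lemma halfK u : 2^-1 *: (u + u) = u.
Proof. by rewrite -[u + u]/(u *+ 2) -scaler_nat scalerA mulVf ?two_neq0 ?scale1r. Qed.

Lemma mul_exp m n : algA_mul (vec_exp m) (vec_exp n) = vec_exp (m + n).
Proof.
rewrite /vec_exp linearDl !linearDr /= mul_vec_bb mul_vec_ba mul_vec_ab mul_vec_aa.
rewrite -!scalerDr -[n - m]opprB vec_aN [n + m]addrC -[RHS]halfK; congr (_ *: _).
(* The terms of index $m-n$ are moved last and cancel in pairs, leaving [vec_exp (m + n)] twice. *)
by rewrite !addrA [LHS](ACl (1*3*7*5*2*8*6*4)) /= !addrK.
Qed.

(** The exponentials span: $2b_n = e_n + e_{-n}$ and $2a_n = e_n - e_{-n}$. *)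
Lemma exp_linear_ind (P : algA F -> Prop) :
    P 0 -> (forall k u v, P u -> P v -> P (k *: u + v)) ->
    (forall m, P (vec_exp m)) ->
  forall u, P u.
Proof.
move=> P0 PD Pe.
have PZ k u : P u -> P (k *: u) by move=> Pu; rewrite -[_ *: _]addr0; apply: PD.
elim/freeg_linear_ind => // -[] n.
  rewrite -[<<_>>]halfK; apply: PZ.
  have -> : << inl n >> + << inl n >> = 1 *: vec_exp n + vec_exp (- n%:Z).
    by rewrite scale1r /vec_exp vec_aN vec_bN addrACA subrr addr0.
  exact: PD.
rewrite -[<<_>>]halfK; apply: PZ.
have -> : << inr n >> + << inr n >> = - 1 *: vec_exp (- n.+1%:Z) + vec_exp n.+1.
  by rewrite scaleN1r /vec_exp vec_aN vec_bN opprD opprK addrACA addNr add0r.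
exact: PD.
Qed.

Lemma algA_mulC : commutative (@algA_mul F).
Proof.
move=> u v; elim/exp_linear_ind: u => [|k u u' IH IH'|m].
- by rewrite linear0l linear0r.
- by rewrite linearPl linearPr /= IH IH'.
elim/exp_linear_ind: v => [|k v v' IH IH'|n].
- by rewrite linear0l linear0r.
- by rewrite linearPl linearPr /= IH IH'.
by rewrite !mul_exp addrC.
Qed.

Lemma algA_mulA : associative (@algA_mul F).
Proof.
move=> u v w; elim/exp_linear_ind: u => [|k u u' IH IH'|m].
- by rewrite !linear0l.
- by rewrite !linearPl /= IH IH'.
elim/exp_linear_ind: v => [|k v v' IH IH'|n].
- by rewrite linear0l !linear0r linear0l.
- by rewrite linearPl !linearPr /= linearPl /= IH IH'.
elim/exp_linear_ind: w => [|k w w' IH IH'|p].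
- by rewrite !linear0r.
- by rewrite !linearPr /= IH IH'.
by rewrite !mul_exp addrA.
Qed.

(** On exponentials the Leibniz rule is $(m+n)e_{m+n} = m e_{m+n} + n e_{m+n}$. *)
Lemma D0_mul u v : D0 (algA_mul u v) = algA_mul (D0 u) v + algA_mul u (D0 v).
Proof.
elim/exp_linear_ind: u => [|k u u' IH IH'|m].
- by rewrite !(linear0, linear0l) addr0.
- by rewrite !(linearP, linearPl) /= IH IH' scalerDr addrACA.
elim/exp_linear_ind: v => [|k v v' IH IH'|n].
- by rewrite !(linear0, linear0r) addr0.
- by rewrite !(linearP, linearPr) /= IH IH' scalerDr addrACA.
by rewrite mul_exp !D0_exp linearZl_LR linearZr_LR /= mul_exp -scalerDl -intrD.
Qed.

Lemma scaled_D0_linear (a : algA F) : linear (scaled_D0 a).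
Proof. by move=> k u v; rewrite /scaled_D0 linearP linearPr. Qed.

(** A multiple of a derivation is a derivation, since [a] can be moved past [u]. *)
Lemma scaled_D0_mul (a u v : algA F) :
  scaled_D0 a (algA_mul u v) =
    algA_mul (scaled_D0 a u) v + algA_mul u (scaled_D0 a v).
Proof.
rewrite /scaled_D0 D0_mul linearDr /= !algA_mulA.
by rewrite [algA_mul u a]algA_mulC.
Qed.

End AlgebraA.

Theorem theorem2p4 (F : fieldType) (charF : 2%N \notin [pchar F])
    (a : algA F) :
  is_novikov (circ a) /\
  (is_lie_bracket (adjoining_bracket (circ a)) /\
   forall b c : algA F,
     adjoining_bracket (circ a) b c =
       algA_mul a (algA_mul b (D0 c) - algA_mul c (D0 b))).
Proof.
have novikov : is_novikov (circ a).
  apply: gelfand_novikov (algA_mulA charF) (algA_mulC charF) _ _.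
  - by split; [exact: algA_mul_linearl | exact: algA_mul_linearr].
  - exact: scaled_D0_linear.
  - exact: scaled_D0_mul.
split=> //; split=> [|b c]; first exact/left_symmetric_lie/novikov_left_symmetric.
rewrite linearBr /= /adjoining_bracket /circ /scaled_D0 !algA_mulA //.
(* After reassociation the two sides differ only by $ba$ against $ab$ and $ca$ against $ac$. *)
by rewrite !(algA_mulC charF _ a).
Qed.
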